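(* For every integer $n\ge 1$ and every $x\in I=[\tfrac12,1]$, $$-\ln\tfrac{10}{9}\,\bigl|r_{[\sqrt n]}\bigr|\ \le\ f_n(x)-\frac{1}{\ln\frac{10}{9}}\ln\frac{5(x+1)}{3(x+2)}\ \le\ \ln\tfrac{10}{9}\,\bigl|d_{[\sqrt n]}\bigr|,$$ where $[\cdot]$ denotes the integer part and, for integers $n\ge1$, $$r_n=-\frac1{\ln\frac{10}{9}}+\left(\frac{60}{7}-\frac{\frac{15}{4}-\frac{99}{4}\gamma_n}{\frac{15}{4}\ln\frac{10}{9}+\frac{384}{225}\gamma_n}\right)\left(1-\tfrac{15}{4}\ln\tfrac{10}{9}-\tfrac{384}{225}\gamma_n\right)^{n-1}+\frac{\frac{15}{4}-\frac{99}{4}\gamma_n}{\frac{15}{4}\ln\frac{10}{9}+\frac{384}{225}\gamma_n},$$ $$d_n=-\frac1{\ln\frac{10}{9}}+\left(\frac{21}{2}-\frac{\frac{99}{4}\gamma_n+\frac{15}{4}}{\frac{15}{4}\ln\frac{10}{9}-\frac{384}{225}\gamma_n}\right)\left(1-\tfrac{15}{4}\ln\tfrac{10}{9}+\tfrac{384}{225}\gamma_n\right)^{n-1}+\frac{\frac{99}{4}\gamma_n+\frac{15}{4}}{\frac{15}{4}\ln\frac{10}{9}-\frac{384}{225}\gamma_n},$$ $$\gamma_n=\frac{1}{\frac{4}{17}\left(\frac{5+\sqrt{17}}{4}\left(\frac{1+\sqrt{17}}{4}\right)^{n}-\frac{5-\sqrt{17}}{4}\left(\frac{1-\sqrt{1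7}}{4}\right)^{n}\right)\left(\frac{3+\sqrt{17}}{2}\left(\frac{1+\sqrt{17}}{4}\right)^{n}-\frac{3-\sqrt{17}}{2}\left(\frac{1-\sqrt{17}}{4}\right)^{n}\right)}.$$
   Context: Let $A=\{\tfrac12,1\}$ and $I=[\tfrac12,1]$. For positive reals $a_1,a_2,\dots$, $[0;a_1,a_2,\dots]$ denotes the continued fraction $\cfrac{1}{a_1+\cfrac{1}{a_2+\cdots}}$. Every $x\in I$ has an expansion $x=[0;\alpha_1,\alpha_2,\dots]$ with all $\alpha_k\in A$. The expansion is unique except for a countable set of points having exactly two expansions, $[0;b_1,\dots,b_n,\tfrac12,(\tfrac12,1)]=[0;b_1,\dots,b_n,1,(1,\tfrac12)]$ (parentheses denote a period); for these points one of the two expansions is fixed once and for all (the choice does not affect Lebesgue measures). The shift is $T^n([0;\alpha_1,\alpha_2,\dots])=[0;\alpha_{n+1},\alpha_{n+2},\dots]$, a map $I\to I$, and for $S\subseteq I$, $T^{-n}(S)=\{x\in I: T^n(x)\in S\}$. With $\lambda$ Lebesgue measure, $f_n(x)=2\lambda\bigl(T^{-n}([\tfrac12,x])\bigr)$ for $x\in I$. *)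

(* Defs.v *)
From HB Require Import structures.
From mathcomp Require Import all_boot all_order all_algebra.
From mathcomp Require Import all_classical all_reals all_analysis.
Import Order.TTheory GRing.Theory Num.Theory.
Import numFieldNormedType.Exports.

Set Implicit Arguments.
Unset Strict Implicit.
Unset Printing Implicit Defensive.

Local Open Scope classical_set_scope.
Local Open Scope ring_scope.

Section ContinuedFractions.
Context {R : realType}.

(* Digits are numbered from 0: [a k] is the (k+1)-st partial quotient, and
   [convergent a n] is [0; a 0, ..., a (n-1)]. *)
Fixpoint convergent (a : nat -> R) (n : nat) : R :=
  if n is m.+1 then (a 0%N + convergent (fun k => a k.+1) m)^-1 else 0.

Definition cfrac (a : nat -> R) : R := limn (convergent a).

Definition digits : set R := [set 2^-1; 1].

Definition Ihalf : set R := `[2^-1, 1].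

Definition is_expansion (x : R) (a : nat -> R) : Prop :=
  (forall k, digits (a k)) /\ convergent a @ \oo --> x.

(* Some points of [Ihalf] have two expansions; such an [alpha] fixes one expansion
   of every point of [Ihalf], and its values outside [Ihalf] play no role. *)
Definition expansion_choice (alpha : R -> nat -> R) : Prop :=
  forall x, Ihalf x -> is_expansion x (alpha x).

Variable alpha : R -> nat -> R.

(* [cf_shift n] drops the first [n] digits of the chosen expansion. At a point with
   two expansions this may differ from the n-th iterate of [cf_shift 1]. *)
Definition cf_shift (n : nat) (x : R) : R := cfrac (fun k => alpha x (n + k)%N).

Definition cf_shift_preimage (n : nat) (S : set R) : set R :=
  [set x | Ihalf x /\ S (cf_shift n x)].

Definition distr_shift (n : nat) (x : R) : R :=
  2 * fine (lebesgue_measure (cf_shift_preimage n `[2^-1, x])).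

End ContinuedFractions.

Section Bounds.
Variable R : realType.

Let s : R := Num.sqrt 17.
Let L : R := ln (10 / 9).

Definition gamma_ (n : nat) : R :=
  1 / (4 / 17
       * ((5 + s) / 4 * ((1 + s) / 4) ^+ n - (5 - s) / 4 * ((1 - s) / 4) ^+ n)
       * ((3 + s) / 2 * ((1 + s) / 4) ^+ n - (3 - s) / 2 * ((1 - s) / 4) ^+ n)).

(* [r_] and [d_] are meant for n >= 1, where [n.-1] is a genuine predecessor. *)
Definition r_ (n : nat) : R :=
  let c := (15 / 4 - 99 / 4 * gamma_ n) / (15 / 4 * L + 384 / 225 * gamma_ n) in
  - (1 / L)
  + (60 / 7 - c) * (1 - 15 / 4 * L - 384 / 225 * gamma_ n) ^+ n.-1
  + c.

Definition d_ (n : nat) : R :=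
  let c := (99 / 4 * gamma_ n + 15 / 4) / (15 / 4 * L - 384 / 225 * gamma_ n) in
  - (1 / L)
  + (21 / 2 - c) * (1 - 15 / 4 * L + 384 / 225 * gamma_ n) ^+ n.-1
  + c.

End Bounds.

(* Main.v *)
Require Import Defs.
From HB Require Import structures.
From mathcomp Require Import all_boot all_order all_algebra.
From mathcomp Require Import all_classical all_reals all_analysis.
From mathcomp Require Import ring lra zify.
Import Order.TTheory GRing.Theory Num.Theory.
Import numFieldNormedType.Exports.
Local Open Scope classical_set_scope.
Local Open Scope ring_scope.

(** Write [branch d t = 1 / (d + t)].  Up to finitely many points, the preimage
    of an interval under the shift is the union of its images by [branch 1] and
    [branch 2^-1], so its distribution function obeys the Gauss-Kuzmin recursion
    [shift_cdf]: each step composes with the two branches ([distr_shiftE]).  No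
    choice of expansions matters, because a point reached through the open
    interval ]1/2, 1[ has its first digits, and its tail, determined.

    Divide the density of [shift_cdf n] by the invariant density
    1 / ((x + 1) (x + 2)), whose primitive is [invariant_cdf].  The quotient
    [rel_density n] is transformed by a Markov operator
      h |-> w h(1 / (1 + x)) + (1 - w) h(1 / (1/2 + x)),  w = (x+1)/(2x+3).
    Averaging never enlarges the range, and since both branches are
    non-expansive, the first one contracting, while w varies slowly, the
    Lipschitz constant is multiplied by at most 13/16
    ([rel_density_lipschitz]).  A relative density lying between a and b forces
    the distribution function to be within ln (10/9) (b - a) / 4 of the limit
    law, because the two have the same total mass ([cdf_error_of_range]).  So
    the error is at most a constant times (13/16)^n, and at most 5/8 ln (10/9)
    from n = 1 on.

    It remains to see that the right-hand sides are larger.  For m = 1 they are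
    |1 - 60/7 ln (10/9)| and |21/2 ln (10/9) - 1|, both above 5/8 ln (10/9).
    For m >= 2, [r_ m] and [d_ m] are each a sum of two terms of the same sign,
    the second of which is of the order of [gamma_ m] ([r_lower], [d_lower]).
    By the recurrences behind its closed form, [gamma_ m] is at least
    (9/16)^m / 4 ([gamma_ge]), while n >= m^2 makes (13/16)^n much smaller. *)

(** * Expansions and their tails *)

Section Expansions.
Context {R : realType}.
Implicit Types (a : nat -> R) (x t : R) (B C : set R).

Definition branch (d t : R) : R := (d + t)^-1.

Lemma IhalfE x : Ihalf x = (2^-1 <= x <= 1) :> Prop.
Proof. by rewrite /Ihalf /= in_itv. Qed.

Lemma digits_bounds d : @digits R d -> 2^-1 <= d /\ d <= 1.
Proof. by case=> ->; split; lra. Qed.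

Lemma convergent_ge0 a n : (forall k, digits (a k)) -> 0 <= convergent a n.
Proof.
elim: n a => [|n IH] a da //=.
rewrite invr_ge0 addr_ge0 ?IH//.
by have [? ?] := digits_bounds _ (da 0%N); lra.
Qed.

Lemma convergent_le2 a n : (forall k, digits (a k)) -> convergent a n <= 2.
Proof.
case: n a => [|n] a da /=; first lra.
have p : 2^-1 <= a 0%N + convergent (fun k => a k.+1) n.
  have := @convergent_ge0 (fun k => a k.+1) n (fun k => da k.+1).
  by have [? ?] := digits_bounds _ (da 0%N); lra.
rewrite invf_ple ?posrE //; by apply: lt_le_trans p; lra.
Qed.

Lemma expansion_gt0 x a : is_expansion x a -> 0 < x.
Proof.
move=> [da ca]; apply: (@lt_le_trans _ _ 3^-1); first lra.
have ca1 := cvgP _ ca.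
have <- := cvg_lim (@Rhausdorff R) ca.
apply: limr_ge => //.
exists 1%N => // -[//|n] _ /=.
have g := @convergent_ge0 (fun k => a k.+1) n (fun k => da k.+1).
have l := @convergent_le2 (fun k => a k.+1) n (fun k => da k.+1).
have [p q] := digits_bounds _ (da 0%N).
by rewrite lef_pV2 ?posrE; lra.
Qed.

Lemma expansion_tail x a : is_expansion x a ->
  exists2 t, is_expansion t (fun k => a k.+1) & x = branch (a 0%N) t.
Proof.
move=> ex; have x0 := expansion_gt0 _ _ ex; case: ex => da ca.
exists (x^-1 - a 0%N); last by rewrite /branch addrC subrK invrK.
split; first by move=> k; exact: da.
have -> : convergent (fun k => a k.+1)
          = (fun n => (convergent a n.+1)^-1 - a 0%N).
  by apply/funext => n /=; rewrite invrK addrC addKr.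
apply: cvgB; last exact: cvg_cst.
apply: cvgV; first by rewrite gt_eqF.
by rewrite (cvg_shiftS (convergent a)).
Qed.

(** The convergents themselves leave [1/2, 1], so the upper bound is improved
    from infinitely far down the expansion: if all tails are at most 1 + e, then
    the tail before is at least 1 / (2 + e), and the one before that at most
    1 + e / (4 + e). *)
Lemma expansion_le1D j x a : is_expansion x a -> x <= 1 + 4^-1 ^+ j.
Proof.
elim: j x a => [|j IH] x a ex.
  have [da ca] := ex; rewrite expr0.
  have <- := cvg_lim (@Rhausdorff R) ca.
  apply: limr_le; first exact: cvgP ca.
  by apply: nearW => n; apply: convergent_le2.
have [t et ->] := expansion_tail _ _ ex.
have [t' et' tE] := expansion_tail _ _ et.
have t'0 := expansion_gt0 _ _ et'.
have t0 := expansion_gt0 _ _ et.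
have le := IH _ _ et'.
have [p q] := digits_bounds _ (ex.1 0%N).
have [p' q'] := digits_bounds _ (et.1 0%N).
have : 0 < 4^-1 ^+ j :> R by apply: exprn_gt0; lra.
rewrite exprS; move: (4^-1 ^+ j) le => e le e0.
have t1 : (2 + e)^-1 <= t by rewrite tE /branch lef_pV2 ?posrE; lra.
have s1 : (2 + e)^-1 * (2 + e) = 1 by rewrite mulVf ?gt_eqF//; lra.
rewrite /branch invf_ple ?posrE; [|lra|lra].
move: (2 + e)^-1 t1 s1 => i t1 s1.
apply: (@le_trans _ _ (2^-1 + i)); last lra.
rewrite -[leLHS]mul1r ler_pdivrMr; last lra.
nra.
Qed.

Lemma expansion_Ihalf x a : is_expansion x a -> Ihalf x.
Proof.
have le1 (y : R) b : is_expansion y b -> y <= 1.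
  move=> ey; apply/ler_addgt0Pl => e e0.
  have [j _ /(_ j (leqnn j))] : \forall j \near \oo, 4^-1 ^+ j < e.
    have /cvgr0_norm_lt /(_ e e0) : (fun j => 4^-1 ^+ j : R) @ \oo --> (0 : R).
      by apply: cvg_expr; rewrite ger0_norm; lra.
    apply: filterS => j; apply: le_lt_trans; exact: ler_norm.
  by have := expansion_le1D j _ _ ey => /=; lra.
move=> ex; rewrite IhalfE (le1 _ _ ex) andbT.
have [t et ->] := expansion_tail _ _ ex.
have t0 := expansion_gt0 _ _ et; have t1 := le1 _ _ et.
have [p q] := digits_bounds _ (ex.1 0%N).
by rewrite /branch lef_pV2 ?posrE; lra.
Qed.

End Expansions.

(** * Preimages under the shift *)

Section ShiftPreimages.
Context {R : realType}.
Implicit Types (a : nat -> R) (d p q t : R) (B C : set R).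

(** The preimage of B under the shift, read off from the inverse branches and
    thus independent of any choice of expansions. *)
Definition pullback B : set R := branch 1 @` B `|` branch 2^-1 @` B.

Lemma branch_gt0 d t : digits d -> 0 < t -> 0 < branch d t.
Proof.
by move=> /digits_bounds[? ?] ?; rewrite invr_gt0; lra.
Qed.

Lemma pullbackP B t : pullback B t <->
  exists d s, [/\ digits d, B s & t = branch d s].
Proof.
split=> [[] [s Bs <-]|[d [s [[] -> Bs ->]]]].
- by exists 1, s; split=> //; right.
- by exists 2^-1, s; split=> //; left.
- by right; exists s.
- by left; exists s.
Qed.

Lemma iter_pullbackU n B C :
  iter n pullback (B `|` C) = iter n pullback B `|` iter n pullback C.
Proof.
elim: n => //= n ->; rewrite /pullback !image_setU.
by rewrite setUACA.
Qed.

Lemma finite_iter_pullback n B : finite_set B -> finite_set (iter n pullback B).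
Proof.
move=> fB; elim: n => //= n IH.
by rewrite finite_setU; split; apply: finite_image.
Qed.

Lemma iter_pullback_interior n B : B `<=` `]2^-1, 1[%classic ->
  iter n pullback B `<=` `]2^-1, 1[%classic.
Proof.
move=> BI; elim: n => //= n IH y /pullbackP[d [s [dd /IH + ->]]].
rewrite /= !in_itv /= => /andP[s1 s2].
have [d1 d2] := digits_bounds _ dd.
by rewrite /branch ltf_pV2 ?posrE ?invf_lt1; lra.
Qed.

(** The images of [1/2, 1] by the two branches meet only at 2/3, the image of an
    end point; requiring one of the two tails to be interior is enough to
    recover digit and tail. *)
Lemma branch_inj d d' t t' : digits d -> digits d' ->
  2^-1 < t < 1 -> 2^-1 <= t' <= 1 -> branch d t = branch d' t' ->
  d = d' /\ t = t'.
Proof.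
by case=> -> [] -> /andP[? ?] /andP[? ?] /invr_inj ?; split; lra.
Qed.

(** Additivity of the measure comes from here: open intervals are pulled back
    exactly disjointly, without discarding any null set. *)
Lemma disjoint_iter_pullback n B C :
  B `<=` `]2^-1, 1[%classic -> C `<=` `]2^-1, 1[%classic -> B `&` C = set0 ->
  iter n pullback B `&` iter n pullback C = set0.
Proof.
move=> BI CI BC; elim: n => //= n IH; rewrite -subset0 => y [].
move=> /pullbackP[d [s [dd Bs ->]]] /pullbackP[d' [s' [dd' Cs']]] E.
have /= := iter_pullback_interior n _ BI _ Bs; rewrite in_itv /= => sI.
have /= := iter_pullback_interior n _ CI _ Cs'; rewrite in_itv /= => /andP[s1 s2].
have [|_ ss'] := branch_inj _ _ _ _ dd dd' sI _ E.
  by rewrite !ltW.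
suff : (set0 : set R) s by [].
by rewrite -IH; split; [exact: Bs|rewrite ss'].
Qed.

Lemma branch_itv d p q : digits d -> 0 < p -> p <= q ->
  branch d @` `]p, q[ = `]branch d q, branch d p[%classic.
Proof.
move=> dd p0 pq; have [d1 d2] := digits_bounds _ dd.
apply/seteqP; split=> y /=.
  move=> [t]; rewrite /= !in_itv /= => /andP[pt tq] <-.
  by rewrite /branch !ltf_pV2 ?posrE; lra.
rewrite in_itv /= /branch => /andP[y1 y2]; exists (y^-1 - d).
  have y0 : 0 < y by apply: lt_trans y1; rewrite invr_gt0; lra.
  have l1 : d + p < y^-1 by rewrite -[ltLHS]invrK ltf_pV2 ?posrE ?invr_gt0; lra.
  have l2 : y^-1 < d + q by rewrite -[ltRHS]invrK ltf_pV2 ?posrE ?invr_gt0; lra.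
  by rewrite /= in_itv /=; apply/andP; split; lra.
by rewrite /branch addrC subrK invrK.
Qed.

(** Together with [pullback_cfrac_shift], this squeezes the preimage of
    [1/2, x] between the pullbacks of the open and of the closed interval. *)
Lemma cfrac_shift_pullback n x a B : is_expansion x a ->
  B (cfrac (fun k => a (n + k)%N)) -> iter n pullback B x.
Proof.
elim: n x a => [|n IH] x a ex.
  by rewrite /cfrac (cvg_lim (@Rhausdorff R) ex.2).
have [t et ->] := expansion_tail _ _ ex.
move=> Bc; apply/pullbackP; exists (a 0%N), t; split=> //; first exact: ex.1.
exact: IH _ _ et Bc.
Qed.

Lemma pullback_cfrac_shift n x a B : B `<=` `]2^-1, 1[%classic -> is_expansion x a ->
  iter n pullback B x -> B (cfrac (fun k => a (n + k)%N)).
Proof.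
move=> BI; elim: n x a => [|n IH] x a ex.
  by rewrite /cfrac (cvg_lim (@Rhausdorff R) ex.2).
have [t et ->] := expansion_tail _ _ ex.
move=> /pullbackP[d [s [dd Bs]]] /esym E.
have /= := iter_pullback_interior n _ BI _ Bs; rewrite in_itv /= => sI.
have := expansion_Ihalf _ _ et; rewrite IhalfE => tI.
have [_ st] := branch_inj _ _ _ _ dd (ex.1 0%N) sI tI E.
by apply: (IH _ _ et); rewrite -st.
Qed.

(** The distribution function of the n-th shift up to an additive constant;
    only its increments are meaningful.  The minus signs are there because both
    branches are decreasing. *)
Fixpoint shift_cdf n (t : R) : R :=
  if n is m.+1 then - shift_cdf m (branch 1 t) - shift_cdf m (branch 2^-1 t)
  else 2 * t.

(** Pulling back once more turns ]p, q[ into its two branch images, so the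
    induction runs on the innermost interval, whose iterated pullback stays a
    disjoint union. *)
Lemma measurable_iter_pullback_itv n p q : 2^-1 <= p -> p <= q -> q <= 1 ->
  measurable (iter n pullback `]p, q[%classic) /\
  lebesgue_measure (iter n pullback `]p, q[%classic)
    = ((shift_cdf n q - shift_cdf n p) / 2)%:E.
Proof.
elim: n p q => [|n IH] p q p1 pq q1.
  split; first exact: measurable_itv.
  rewrite lebesgue_measure_itv /= lte_fin.
  have [pq'|] := ltP; first by rewrite -EFinB; congr EFin; field.
  move=> qp; have -> : p = q by apply/le_anti/andP.
  by rewrite subrr mul0r.
have p0 : 0 < p by lra.
have d1 : digits (1 : R) by right.
have dh : digits (2^-1 : R) by left.
rewrite iterSr /pullback !branch_itv // iter_pullbackU.
have le d : digits d -> branch d q <= branch d p.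
  by move=> /digits_bounds[? ?]; rewrite /branch lef_pV2 ?posrE; lra.
have b1 : 2^-1 <= branch 1 q by rewrite /branch lef_pV2 ?posrE; lra.
have b2 : branch 1 p <= branch 2^-1 q by rewrite /branch lef_pV2 ?posrE; lra.
have b3 : branch 2^-1 p <= 1 by rewrite /branch invf_le1; lra.
have l1 := le _ d1; have lh := le _ dh.
have b1' : branch 1 p <= 1 by exact: le_trans b2 (le_trans lh b3).
have b3' : 2^-1 <= branch 2^-1 q by exact: le_trans b1 (le_trans l1 b2).
have [m1 e1] := IH _ _ b1 l1 b1'.
have [mh eh] := IH _ _ b3' lh b3.
split; first exact: measurableU.
set A1 := iter n pullback _ in m1 e1 *; set A2 := iter n pullback _ in mh eh *.
have disj : A1 `&` A2 = set0.
  apply: disjoint_iter_pullback.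
  - by move=> y /=; rewrite !in_itv /= => /andP[? ?]; lra.
  - by move=> y /=; rewrite !in_itv /= => /andP[? ?]; lra.
  - rewrite -subset0 => y [] /=; rewrite !in_itv /= => /andP[? ?] /andP[? ?].
    lra.
apply: (etrans (measureU lebesgue_measure m1 mh disj)).
by apply: (etrans (congr2 adde e1 eh)); rewrite /=; congr EFin; field.
Qed.

(** The preimage of [1/2, x] consists of the pullback of the open interval and
    of points pulled back from 1/2 or x, which are finitely many. *)
Lemma distr_shiftE (alpha : R -> nat -> R) n x :
  expansion_choice alpha -> Ihalf x ->
  distr_shift alpha n x = shift_cdf n x - shift_cdf n 2^-1.
Proof.
move=> halpha; rewrite IhalfE => /andP[x1 x2].
rewrite /distr_shift; set E := cf_shift_preimage _ _ _.
set O := iter n pullback `]2^-1, x[%classic.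
have OI : `]2^-1, x[%classic `<=` (`]2^-1, 1[%classic : set R).
  by move=> y /=; rewrite !in_itv /= => /andP[? ?]; lra.
have OE : O `<=` E.
  move=> y Oy; have yI : Ihalf y.
    have := iter_pullback_interior n _ OI _ Oy.
    by rewrite IhalfE /= in_itv /= => /andP[? ?]; lra.
  split=> //.
  have := pullback_cfrac_shift n _ _ _ OI (halpha _ yI) Oy.
  rewrite /cf_shift /= !in_itv /= => /andP[? ?]; lra.
pose P := [set 2^-1; x].
have EO : E `\` O `<=` iter n pullback P.
  move=> y [[yI Ey] nO].
  have : iter n pullback (`]2^-1, x[%classic `|` P) y.
    apply: cfrac_shift_pullback (halpha _ yI) _.
    move: Ey; rewrite /cf_shift; move: (cfrac _) => c /=.
    rewrite !in_itv /= => /andP[c1 c2]; rewrite /P /=.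
    have [->|c3] := eqVneq c 2^-1; first by right; left.
    have [->|c4] := eqVneq c x; first by right; right.
    by left; rewrite !lt_neqAle c1 c2 c4 eq_sym c3.
  by rewrite iter_pullbackU => -[].
have fin : finite_set (E `\` O).
  apply: sub_finite_set EO _; apply: finite_iter_pullback.
  by rewrite finite_setU; split; exact: finite_set1.
have [mO eO] := measurable_iter_pullback_itv n _ _ (lexx _) x1 x2.
have -> : E = O `|` (E `\` O) by rewrite setDUK.
have cD := finite_set_countable fin.
have mD := countable_measurable (@measurable_set1 R) cD.
have mU := measureU lebesgue_measure mO mD (setDIK _ _).
rewrite [lebesgue_measure _](etrans mU
  (congr2 adde eO (countable_lebesgue_measure0 cD))).
by rewrite /=; field.
Qed.

End ShiftPreimages.

(** * The density relative to the invariant one *)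

Section Densities.
Context {R : realType}.
Implicit Types (x y t : R).

(** The density of [shift_cdf n] divided by 1 / ((x + 1) (x + 2)).  The weights
    are the conditional probabilities of the two digits under the invariant
    law and add up to 1. *)
Fixpoint rel_density n x : R :=
  if n is m.+1 then
    (x + 1) / (2 * x + 3) * rel_density m (branch 1 x)
    + (x + 2) / (2 * x + 3) * rel_density m (branch 2^-1 x)
  else 2 * (x + 1) * (x + 2).

Lemma is_derive_branch d x : 0 < d + x ->
  is_derive x 1 (branch d) (- (branch d x) ^+ 2).
Proof.
move=> dx; have dx0 : (cst d + id : R -> R) x != 0 by rewrite gt_eqF.
have D := is_deriveV dx0 (is_deriveD (is_derive_cst d x 1) (is_derive_id x (1 : R))).
apply: (is_derive_eq D).
by rewrite add0r /GRing.scale /= mulr1 /branch exprVn.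
Qed.

Lemma is_derive_shift_cdf n x : 0 < x ->
  is_derive x 1 (shift_cdf n) (rel_density n x / ((x + 1) * (x + 2))).
Proof.
elim: n x => [|n IH] x x0 /=.
  apply: (is_derive_eq (is_deriveZ (2 : R) (is_derive_id x (1 : R)))).
  rewrite /GRing.scale /=; field.
  by apply/andP; split; rewrite gt_eqF //; lra.
have p1 : 0 < branch 1 x by rewrite invr_gt0; lra.
have ph : 0 < branch 2^-1 x by rewrite invr_gt0; lra.
have D1 : is_derive x 1 (branch 1) (- (branch 1 x) ^+ 2).
  by apply: is_derive_branch; lra.
have Dh : is_derive x 1 (branch 2^-1) (- (branch 2^-1 x) ^+ 2).
  by apply: is_derive_branch; lra.
have C1 := @is_derive1_comp R (shift_cdf n) _ x _ _ (IH _ p1) D1.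
have Ch := @is_derive1_comp R (shift_cdf n) _ x _ _ (IH _ ph) Dh.
apply: (is_derive_eq (is_deriveB (is_deriveN C1) Ch)).
move: (rel_density n _) (rel_density n _) => r1 rh; rewrite /branch.
field.
by apply/and5P; split; rewrite gt_eqF //; lra.
Qed.

(** The primitive of 1 / ((x + 1) (x + 2)) that vanishes at 1/2; its total mass
    ln (10 / 9) on [1/2, 1] is not normalised. *)
Definition invariant_cdf x : R := ln (5 * (x + 1) / (3 * (x + 2))).

Lemma is_derive_invariant_cdf x : 0 < x ->
  is_derive x 1 invariant_cdf ((x + 1) * (x + 2))^-1.
Proof.
move=> x0; have D2 : is_derive x 1 (branch 2) (- (branch 2 x) ^+ 2).
  by apply: is_derive_branch; lra.
have D := is_deriveB (is_derive_cst (5 / 3 : R) x (1 : R)) (is_deriveZ (5 / 3 : R) D2).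
pose g : R -> R := cst (5 / 3) - (5 / 3) *: (branch 2 : R -> R).
have gE y : 0 < y -> g y = 5 * (y + 1) / (3 * (y + 2)).
  by move=> y0; rewrite /g !fctE /GRing.scale /= /branch; field; rewrite gt_eqF //; lra.
have g0 : 0 < g x by rewrite gE // divr_gt0 //; lra.
have C := @is_derive1_comp R (@ln R) g x _ _ (is_derive1_ln g0) D.
have nE : \near x, (@ln R \o g) x = invariant_cdf x.
  near=> y.
  by rewrite /= /invariant_cdf gE //; near: y; exact: lt_nbhsr.
apply: (near_eq_is_derive nE).
apply: (is_derive_eq C).
rewrite gE // /GRing.scale /= /branch; field.
by apply/andP; split; rewrite gt_eqF //; lra.
Unshelve. all: end_near. Qed.

Lemma le_of_derive_ge0 (g dg : R -> R) p q : p <= q ->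
  (forall x, p <= x <= q -> is_derive x 1 g (dg x)) ->
  (forall x, p <= x <= q -> 0 <= dg x) -> g p <= g q.
Proof.
move=> pq Dg dg0.
have [||c cpq E] := @MVT_segment R g dg p q pq.
- by move=> x; rewrite in_itv /= => /andP[? ?]; apply: Dg; rewrite !ltW.
- apply: derivable_within_continuous => x; rewrite in_itv /= => xpq.
  by have [] := Dg x xpq.
by rewrite -subr_ge0 E mulr_ge0 ?subr_ge0 // dg0 //.
Qed.

(** Integrates the bounds on the density, in the form: subtracting a times the
    invariant function leaves a nondecreasing one. *)
Lemma shift_cdf_bounds n a b p q :
  (forall x, 2^-1 <= x <= 1 -> a <= rel_density n x <= b) ->
  2^-1 <= p -> p <= q -> q <= 1 ->
  a * (invariant_cdf q - invariant_cdf p) <= shift_cdf n q - shift_cdf n p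
    <= b * (invariant_cdf q - invariant_cdf p).
Proof.
move=> hab p1 pq q1.
have D c x : p <= x <= q ->
    is_derive x 1 (shift_cdf n - c *: invariant_cdf)
      ((rel_density n x - c) / ((x + 1) * (x + 2))).
  move=> /andP[? ?]; have x0 : 0 < x by lra.
  have := is_deriveB (is_derive_shift_cdf n x x0)
                     (is_deriveZ c (is_derive_invariant_cdf x x0)).
  by move=> /is_derive_eq; apply; rewrite mulrBl.
have w0 x : p <= x <= q -> 0 <= ((x + 1) * (x + 2))^-1.
  by move=> /andP[? ?]; rewrite invr_ge0 mulr_ge0; lra.
have := @le_of_derive_ge0 _ _ p q pq (D a) _.
have := @le_of_derive_ge0 _ _ p q pq (fun x xpq => is_deriveN (D b x xpq)) _.
rewrite !fctE /GRing.scale /= => Hb Ha; apply/andP; split.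
  suff : shift_cdf n p - a * invariant_cdf p
         <= shift_cdf n q - a * invariant_cdf q by lra.
  apply: Ha => x xpq; rewrite mulr_ge0 ?w0 // subr_ge0.
  have /andP[? ?] := xpq.
  have xI : 2^-1 <= x <= 1 by apply/andP; split; lra.
  by have /andP[] := hab x xI.
suff : - (shift_cdf n p - b * invariant_cdf p)
       <= - (shift_cdf n q - b * invariant_cdf q) by lra.
apply: Hb => x xpq; rewrite -mulNr opprB mulr_ge0 ?w0 // subr_ge0.
have /andP[? ?] := xpq.
have xI : 2^-1 <= x <= 1 by apply/andP; split; lra.
by have /andP[] := hab x xI.
Qed.

Lemma branch_itvP d x : digits d -> 2^-1 <= x <= 1 -> 2^-1 <= branch d x <= 1.
Proof.
move=> /digits_bounds[? ?] /andP[? ?]; rewrite /branch invf_le1; last lra.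
by rewrite lef_pV2 ?posrE; [apply/andP; split|..]; lra.
Qed.

Lemma rel_density_step n a b :
  (forall x, 2^-1 <= x <= 1 -> a <= rel_density n x <= b) ->
  forall x, 2^-1 <= x <= 1 -> a <= rel_density n.+1 x <= b.
Proof.
move=> hab x xI /=.
have /andP[a1 b1] := hab _ (branch_itvP 1 x (or_intror erefl) xI).
have /andP[ah bh] := hab _ (branch_itvP 2^-1 x (or_introl erefl) xI).
move: (rel_density n _) (rel_density n _) a1 b1 ah bh => r1 rh a1 b1 ah bh.
have /andP[x1 x2] := xI.
have w1 : (x + 2) / (2 * x + 3) = 1 - (x + 1) / (2 * x + 3).
  by field; rewrite gt_eqF //; lra.
have w0 : 0 <= (x + 1) / (2 * x + 3) by rewrite divr_ge0; lra.
have wle : (x + 1) / (2 * x + 3) <= 1 by rewrite ler_pdivrMr; lra.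
rewrite w1; move: (_ / _) w0 wle => w w0 wle; apply/andP; split; nra.
Qed.

(** The values for n = 1 are explicit, and averaging keeps them in the same
    range.  The Lipschitz bound alone is too weak for n = 1. *)
Lemma rel_density_range n x : (0 < n)%N -> 2^-1 <= x <= 1 ->
  25 / 3 <= rel_density n x <= 65 / 6.
Proof.
case: n => // n _; elim: n x => [|n IH]; last exact: rel_density_step IH.
move=> x /andP[x1 x2] /=.
(* Rewritten as an increasing function of the two branch values, from which
   both bounds can be read. *)
have -> : (x + 1) / (2 * x + 3) * (2 * (branch 1 x + 1) * (branch 1 x + 2)) +
  (x + 2) / (2 * x + 3) * (2 * (branch 2^-1 x + 1) * (branch 2^-1 x + 2))
  = 2 * (1 + branch 1 x + (1 + branch 2^-1 x / 2) * (1 + 3 * branch 2^-1 x / 2)).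
  rewrite /branch; field.
  by apply/and3P; split; rewrite gt_eqF //; lra.
have w2 : branch 1 x <= 2 / 3 by rewrite /branch -[leRHS]invrK lef_pV2 ?posrE; lra.
have w1 : 1 / 2 <= branch 1 x by rewrite /branch -[leLHS]invrK lef_pV2 ?posrE; lra.
have v2 : branch 2^-1 x <= 1 by rewrite /branch invf_le1; lra.
have v1 : 2 / 3 <= branch 2^-1 x by rewrite /branch -[leLHS]invrK lef_pV2 ?posrE; lra.
move: (branch 1 x) (branch 2^-1 x) w1 w2 v1 v2 => w v w1 w2 v1 v2.
apply/andP; split; nra.
Qed.

Lemma branchB d x y : 0 < d + x -> 0 < d + y ->
  branch d x - branch d y = - (x - y) * (branch d x * branch d y).
Proof.
move=> ? ?; rewrite /branch; field.
by apply/andP; split; rewrite gt_eqF //; lra.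
Qed.

Lemma dist_branch d k x y : 0 < k -> k <= d + x -> k <= d + y ->
  `|branch d x - branch d y| <= k^-1 ^+ 2 * `|x - y|.
Proof.
move=> k0 kx ky; rewrite branchB; [|lra|lra].
rewrite normrM normrN mulrC ler_wpM2r // ger0_norm; last first.
  by rewrite mulr_ge0 // invr_ge0; lra.
by rewrite expr2 ler_pM ?invr_ge0 ?lef_pV2 ?posrE; lra.
Qed.

(** One step of the Markov operator seen from two points: r, s and r', s' are
    the values at the branch images of the points, D their distance, K the
    Lipschitz constant.  The factor is 4/9 w + (1 - w) + 1/48, largest at the
    least weight w = 3/8. *)
Lemma averaging_contraction (K D w w' r r' s s' : R) :
  0 <= K -> 0 <= D -> 3 / 8 <= w <= 1 ->
  `|r - r'| <= 4 / 9 * (K * D) -> `|s - s'| <= K * D ->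
  `|r' - s'| <= K * (1 / 3) -> `|w - w'| <= 1 / 16 * D ->
  `|w * r + (1 - w) * s - (w' * r' + (1 - w') * s')| <= 13 / 16 * (K * D).
Proof.
move=> K0 D0 /andP[w0 w1] Hr Hs Hc Hw.
(* Since weights add up to 1, the variation of w only sees the difference
   r' - s'. *)
have -> : w * r + (1 - w) * s - (w' * r' + (1 - w') * s')
  = w * (r - r') + (1 - w) * (s - s') + (w - w') * (r' - s') by ring.
have T : `|w * (r - r') + (1 - w) * (s - s') + (w - w') * (r' - s')|
   <= w * `|r - r'| + (1 - w) * `|s - s'| + `|w - w'| * `|r' - s'|.
  apply: (le_trans (ler_normD _ _)); rewrite normrM lerD2r.
  apply: (le_trans (ler_normD _ _)).
  by rewrite !normrM (ger0_norm (_ : 0 <= w)) ?(ger0_norm (_ : 0 <= 1 - w)); lra.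
have T1 : w * `|r - r'| <= w * (4 / 9 * (K * D)) by rewrite ler_wpM2l //; lra.
have T2 : (1 - w) * `|s - s'| <= (1 - w) * (K * D) by rewrite ler_wpM2l //; lra.
have T3 : `|w - w'| * `|r' - s'| <= 1 / 16 * D * (K * (1 / 3)) by rewrite ler_pM.
have T4 : 3 / 8 * (K * D) <= w * (K * D) by rewrite ler_wpM2r ?mulr_ge0.
move: (K * D) (mulr_ge0 K0 D0) T1 T2 T4 (mulrC D K) T3 => KD KD0 T1 T2 T4 E.
have -> : 1 / 16 * D * (K * (1 / 3)) = 1 / 48 * KD by rewrite -E; field.
lra.
Qed.

Lemma rel_density_lipschitz n x y : 2^-1 <= x <= 1 -> 2^-1 <= y <= 1 ->
  `|rel_density n x - rel_density n y| <= 10 * (13 / 16) ^+ n * `|x - y|.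
Proof.
elim: n x y => [|n IH] x y xI yI.
  have /andP[x1 x2] := xI; have /andP[y1 y2] := yI.
  have -> : rel_density 0 x - rel_density 0 y = 2 * (x + y + 3) * (x - y).
    by rewrite /=; ring.
  rewrite normrM expr0 mulr1 ler_wpM2r // ger0_norm; lra.
have d1 : digits (1 : R) by right.
have dh : digits (2^-1 : R) by left.
have /andP[x1 x2] := xI; have /andP[y1 y2] := yI.
have B1 : `|branch 1 x - branch 1 y| <= 4 / 9 * `|x - y|.
  by have := @dist_branch 1 (3 / 2) x y ltac:(lra) ltac:(lra) ltac:(lra); lra.
have Bh : `|branch 2^-1 x - branch 2^-1 y| <= `|x - y|.
  by have := @dist_branch 2^-1 1 x y ltac:(lra) ltac:(lra) ltac:(lra); lra.
have Bc : `|branch 1 y - branch 2^-1 y| <= 1 / 3.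
  have -> : branch 1 y - branch 2^-1 y = - ((1 / 2) * (branch 1 y * branch 2^-1 y)).
    rewrite /branch; field.
    by apply/andP; split; rewrite gt_eqF //; lra.
  have b10 : 0 <= branch 1 y by rewrite ltW // branch_gt0 //; lra.
  have bh0 : 0 <= branch 2^-1 y by rewrite ltW // branch_gt0 //; lra.
  have b1 : branch 1 y <= 2 / 3 by rewrite /branch -[leRHS]invrK lef_pV2 ?posrE; lra.
  have /andP[_ bh1] := branch_itvP _ _ dh yI.
  by rewrite normrN ger0_norm; [nra|rewrite mulr_ge0 ?mulr_ge0 //; lra].
have Bw : `|(x + 1) / (2 * x + 3) - (y + 1) / (2 * y + 3)| <= 1 / 16 * `|x - y|.
  have -> : (x + 1) / (2 * x + 3) - (y + 1) / (2 * y + 3)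
            = (x - y) * ((2 * x + 3)^-1 * (2 * y + 3)^-1).
    by field; apply/andP; split; rewrite gt_eqF //; lra.
  rewrite normrM mulrC ler_wpM2r // ger0_norm; last first.
    by rewrite mulr_ge0 // invr_ge0; lra.
  rewrite (_ : 1 / 16 = 4^-1 * 4^-1); last lra.
  by rewrite ler_pM ?invr_ge0 ?lef_pV2 ?posrE; lra.
have w38 : 3 / 8 <= (x + 1) / (2 * x + 3) by rewrite ler_pdivlMr; lra.
have w1 : (x + 1) / (2 * x + 3) <= 1 by rewrite ler_pdivrMr; lra.
have vE t : 2^-1 <= t -> (t + 2) / (2 * t + 3) = 1 - (t + 1) / (2 * t + 3).
  by move=> ?; field; rewrite gt_eqF //; lra.
have H1 := IH _ _ (branch_itvP _ _ d1 xI) (branch_itvP _ _ d1 yI).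
have Hh := IH _ _ (branch_itvP _ _ dh xI) (branch_itvP _ _ dh yI).
have Hc := IH _ _ (branch_itvP _ _ d1 yI) (branch_itvP _ _ dh yI).
have K0 : 0 <= 10 * (13 / 16) ^+ n :> R by rewrite mulr_ge0 // exprn_ge0; lra.
have D0 : 0 <= `|x - y| by [].
rewrite exprS /= !vE //.
have -> : 10 * (13 / 16 * (13 / 16) ^+ n) * `|x - y|
          = 13 / 16 * (10 * (13 / 16) ^+ n * `|x - y|) by ring.
apply: averaging_contraction => //; first by rewrite w38.
- by apply: (le_trans H1); rewrite mulrCA ler_wpM2l.
- by apply: (le_trans Hh); rewrite ler_wpM2l.
- by apply: (le_trans Hc); rewrite ler_wpM2l.
Qed.

End Densities.

(** * Distance to the limit law *)

Section Error.
Context {R : realType}.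
Implicit Types (a b x : R).
Local Notation L := (ln (10 / 9) : R).

Lemma shift_cdf_mass n : shift_cdf n 1 - shift_cdf n 2^-1 = 1 :> R.
Proof.
elim: n => [|n IH] /=; first by field.
rewrite /branch (_ : 2^-1 + 1 = 1 + 2^-1 :> R); last lra.
rewrite (_ : (2^-1 + 2^-1)^-1 = 1 :> R); last by field.
rewrite (_ : (1 + 1)^-1 = 2^-1 :> R); last by field.
lra.
Qed.

Lemma invariant_cdf_half : invariant_cdf 2^-1 = 0 :> R.
Proof. by rewrite /invariant_cdf (_ : _ / _ = 1) ?ln1 //; field. Qed.

Lemma invariant_cdf1 : invariant_cdf 1 = L.
Proof. by rewrite /invariant_cdf; congr ln; field. Qed.

Lemma invariant_cdf_homo (p q : R) : 0 < p -> p <= q ->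
  invariant_cdf p <= invariant_cdf q.
Proof.
move=> p0 pq; apply: (@le_of_derive_ge0 _ _ (fun x => ((x + 1) * (x + 2))^-1)) => //.
  by move=> x /andP[? _]; apply: is_derive_invariant_cdf; lra.
by move=> x /andP[? _]; rewrite invr_ge0 mulr_ge0; lra.
Qed.

(** The bound ln (1 + t) <= t alone gives ln (10/9) <= 1/9, which is not sharp
    enough; splitting 10/9 as 20/19 times 19/18 is.  The lower bound [ln109_ge]
    uses the same splitting. *)
Lemma ln109_le : L <= 1 / 19 + 1 / 18.
Proof.
rewrite (_ : 10 / 9 = (1 + 1 / 19) * (1 + 1 / 18)); last by field.
by rewrite lnM ?posrE; [apply: lerD; apply: le_ln1Dx|..]; lra.
Qed.

Lemma ln109_ge : 1 / 20 + 1 / 19 <= L.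
Proof.
rewrite (_ : 10 / 9 = ((1 + - (1 / 20)) * (1 + - (1 / 19)))^-1); last by field.
rewrite lnV ?posrE; last lra.
rewrite lnM ?posrE; [|lra|lra].
have A : ln (1 + - (1 / 20)) <= - (1 / 20) :> R by apply: le_ln1Dx; lra.
have B : ln (1 + - (1 / 19)) <= - (1 / 19) :> R by apply: le_ln1Dx; lra.
lra.
Qed.

(** With y and y' the invariant masses to the left and right of x, and F, F' the
    masses of the law considered, F + F' = 1 gives F - y / L = (F y' - y F') / L,
    whose absolute value is at most (b - a) y y' / L; finally y + y' = L implies
    that y y' is at most L^2 / 4. *)
Lemma cdf_error_of_range n a b x :
  (forall t, 2^-1 <= t <= 1 -> a <= rel_density n t <= b) ->
  2^-1 <= x <= 1 ->
  `|shift_cdf n x - shift_cdf n 2^-1 - 1 / L * invariant_cdf x|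
    <= L * ((b - a) / 4).
Proof.
move=> hab /andP[x1 x2]; have L0 := ln109_ge.
have := shift_cdf_bounds n a b _ _ hab (lexx _) x1 x2.
have := shift_cdf_bounds n a b _ _ hab x1 x2 (lexx _).
have y'0 := invariant_cdf_homo x 1 ltac:(lra) x2.
have y0 := invariant_cdf_homo 2^-1 x ltac:(lra) x1.
have M := shift_cdf_mass n.
move: y0 y'0 M; rewrite invariant_cdf_half invariant_cdf1 subr0.
move: (invariant_cdf x) (shift_cdf n x) (shift_cdf n 2^-1) (shift_cdf n 1) => y f f0 f1.
move=> y0 yL M /andP[A B] /andP[C D].
rewrite (_ : f - f0 - 1 / L * y = L^-1 * ((f - f0) * (L - y) - y * (f1 - f))); last first.
  have -> : f1 = 1 + f0 by lra.
  by field; rewrite gt_eqF //; lra.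
rewrite normrM ger0_norm ?invr_ge0; last lra.
rewrite ler_pdivrMl; last lra.
have ab : a <= b by have /andP[? ?] := hab 1 ltac:(apply/andP; split; lra); lra.
have K : y * (L - y) <= L ^+ 2 / 4.
  by rewrite -subr_ge0 (_ : _ - _ = (L / 2 - y) ^+ 2) ?sqr_ge0 //; field.
apply: (@le_trans _ _ ((b - a) * (y * (L - y)))); last first.
  have -> : L * (L * ((b - a) / 4)) = (b - a) * (L ^+ 2 / 4) by field.
  by rewrite ler_wpM2l // subr_ge0.
rewrite ler_norml; apply/andP; split.
  have E1 := ler_wpM2r (_ : 0 <= L - y) C.
  have E2 := ler_wpM2l y0 B.
  have : 0 <= L - y by lra.
  move=> /E1; lra.
have E1 := ler_wpM2r (_ : 0 <= L - y) D.
have E2 := ler_wpM2l y0 A.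
have : 0 <= L - y by lra.
move=> /E1; lra.
Qed.

Lemma cdf_error_le n x : (0 < n)%N -> 2^-1 <= x <= 1 ->
  `|shift_cdf n x - shift_cdf n 2^-1 - 1 / L * invariant_cdf x| <= 5 / 8 * L.
Proof.
move=> n0 xI.
apply: (le_trans (cdf_error_of_range n _ _ _ (fun t => rel_density_range n t n0) xI)).
have := ln109_ge; lra.
Qed.

Lemma cdf_error_exp n x : 2^-1 <= x <= 1 ->
  `|shift_cdf n x - shift_cdf n 2^-1 - 1 / L * invariant_cdf x|
    <= 5 / 4 * L * (13 / 16) ^+ n.
Proof.
move=> xI; have K0 : 0 <= (13 / 16) ^+ n :> R by rewrite exprn_ge0; lra.
(* On an interval of length 1/2, measuring from the midpoint 3/4. *)
pose c : R := rel_density n (3 / 4); pose k : R := 10 * (13 / 16) ^+ n / 4.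
have hab t : 2^-1 <= t <= 1 -> c - k <= rel_density n t <= c + k.
  move=> tI; rewrite -ler_distl.
  apply: (le_trans (rel_density_lipschitz n _ _ tI _)).
    by apply/andP; split; lra.
  have /andP[? ?] := tI.
  have tle : `|t - 3 / 4| <= 1 / 4 by rewrite ler_norml; apply/andP; split; lra.
  by have := ler_wpM2l K0 tle; rewrite /k; lra.
apply: (le_trans (cdf_error_of_range n _ _ _ hab xI)).
rewrite (_ : L * _ = 5 / 4 * L * (13 / 16) ^+ n) //.
by rewrite /k; field.
Qed.

End Error.

(** * Size of the two bounds *)

Section GammaBounds.
Context {R : realType}.
Implicit Types (u v a b c : R).
Local Notation L := (ln (10 / 9) : R).
Local Notation s := (Num.sqrt 17 : R).

(** Solutions of u(n+2) = u(n+1) / 2 + u(n), whose characteristic roots are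
    (1 + sqrt 17) / 4 and (1 - sqrt 17) / 4. *)
Fixpoint linrec u v n : R := if n is m.+1 then linrec v (v / 2 + u) m else u.

Lemma sqrt17_sqr : s ^+ 2 = 17.
Proof. by rewrite sqr_sqrtr. Qed.

Lemma linrec_binet n a b :
  linrec (a + b) (a * ((1 + s) / 4) + b * ((1 - s) / 4)) n
  = a * ((1 + s) / 4) ^+ n + b * ((1 - s) / 4) ^+ n.
Proof.
have s2 := sqrt17_sqr.
elim: n a b => [|n IH] a b /=; first by rewrite !expr0 !mulr1.
have Ea : a * s ^+ 2 = 17 * a by rewrite s2 mulrC.
have Eb : b * s ^+ 2 = 17 * b by rewrite s2 mulrC.
have -> : (a * ((1 + s) / 4) + b * ((1 - s) / 4)) / 2 + (a + b)
  = a * ((1 + s) / 4) * ((1 + s) / 4) + b * ((1 - s) / 4) * ((1 - s) / 4) by lra.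
by rewrite IH !exprS !mulrA.
Qed.

Lemma linrec_ge c u v n : 0 <= c -> c <= u -> c <= v -> c <= linrec u v n.
Proof.
move=> c0; elim: n u v => //= n IH u v cu cv; apply: IH => //; lra.
Qed.

(** 4/3 is a convenient upper estimate of the dominant root:
    (4/3) / 2 + 1 <= (4/3)^2. *)
Lemma linrec_le c u v n : 0 <= c -> u <= c -> v <= 4 / 3 * c ->
  linrec u v n <= c * (4 / 3) ^+ n.
Proof.
elim: n c u v => [|n IH] c u v c0 uc vc /=; first by rewrite mulr1.
by rewrite exprS mulrA (mulrC c); apply: IH; lra.
Qed.

Lemma gammaE n : gamma_ R n = 1 / (4 * (linrec (1 / 2) (3 / 4) n * linrec 1 1 n)).
Proof.
have s2 := sqrt17_sqr; have s0 : s != 0 by rewrite gt_eqF // sqrtr_gt0.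
(* Dividing by sqrt 17 makes the initial values rational. *)
have A : (5 + s) / 4 * ((1 + s) / 4) ^+ n - (5 - s) / 4 * ((1 - s) / 4) ^+ n
         = s * linrec (1 / 2) (3 / 4) n.
  have := linrec_binet n ((5 + s) / (4 * s)) (- (5 - s) / (4 * s)).
  rewrite (_ : _ / _ + _ = 1 / 2); last by field.
  rewrite (_ : _ / _ * _ + _ = 3 / 4); last by field.
  by move=> ->; field.
have B : (3 + s) / 2 * ((1 + s) / 4) ^+ n - (3 - s) / 2 * ((1 - s) / 4) ^+ n
         = s * linrec 1 1 n.
  have := linrec_binet n ((3 + s) / (2 * s)) (- (3 - s) / (2 * s)).
  rewrite (_ : _ / _ + _ = 1); last by field.
  rewrite (_ : _ / _ * _ + _ = 1); last by field.
  by move=> ->; field.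
rewrite /gamma_ A B; congr (1 / _).
move: (linrec _ _ _) (linrec _ _ _) => q p.
have -> : 4 / 17 * (s * p) * (s * q) = 4 / 17 * s ^+ 2 * (p * q) by ring.
by rewrite s2; field.
Qed.

Lemma gamma_ge n : (9 / 16) ^+ n / 4 <= gamma_ R n.
Proof.
have p0 : 1 / 2 <= linrec (1 / 2) (3 / 4) n by apply: linrec_ge; lra.
have q0 : 1 <= linrec 1 1 n by apply: linrec_ge; lra.
have p1 : linrec (1 / 2) (3 / 4) n <= 1 * (4 / 3) ^+ n by apply: linrec_le; lra.
have q1 : linrec 1 1 n <= 1 * (4 / 3) ^+ n by apply: linrec_le; lra.
rewrite [leRHS]mul1r in p1; rewrite [leRHS]mul1r in q1.
rewrite gammaE; move: (linrec _ _ _) (linrec _ _ _) p0 q0 p1 q1 => q p p0 q0 p1 q1.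
have pq : p * q <= (16 / 9) ^+ n.
  have -> : 16 / 9 = 4 / 3 * (4 / 3) :> R by field.
  by rewrite exprMn ler_pM //; lra.
have pq0 : 0 < p * q by rewrite mulr_gt0 //; lra.
have E : (9 / 16) ^+ n = ((16 / 9) ^+ n)^-1 :> R.
  by rewrite -exprVn; congr (_ ^+ _); field.
rewrite E mul1r invfM mulrC ler_wpM2l // lef_pV2 ?posrE // exprn_gt0; lra.
Qed.

Lemma gamma_le n : gamma_ R n.+2 <= 4 / 21.
Proof.
have p0 : 7 / 8 <= linrec (1 / 2) (3 / 4) n.+2.
  by rewrite /=; apply: linrec_ge; lra.
have q0 : 3 / 2 <= linrec 1 1 n.+2.
  by rewrite /=; apply: linrec_ge; lra.
rewrite gammaE; move: (linrec _ _ _) (linrec _ _ _) p0 q0 => q p p0 q0.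
have pq : 7 / 8 * (3 / 2) <= p * q by rewrite ler_pM //; lra.
by rewrite ler_pdivrMr; lra.
Qed.

(** A convex combination of A and B / e in which B / e has weight at least e:
    this frees the bounds from the exponent m and from the denominator e. *)
Lemma relax_ge (e Q A B : R) m : 0 < e <= 1 -> 0 <= A -> 0 <= B ->
  Q = (1 - e) ^+ m.+1 -> B <= A * Q + B / e * (1 - Q).
Proof.
move=> /andP[e0 e1] A0 B0 ->.
have Q0 : 0 <= (1 - e) ^+ m.+1 by rewrite exprn_ge0 //; lra.
have Q1 : (1 - e) ^+ m.+1 <= 1 - e.
  by rewrite exprS ler_piMr ?exprn_ile1 //; lra.
have : B / e * e <= B / e * (1 - (1 - e) ^+ m.+1).
  by rewrite ler_wpM2l ?divr_ge0 //; lra.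
rewrite divfK ?gt_eqF //.
have := mulr_ge0 A0 Q0; lra.
Qed.

(** With l = ln (10/9), - l r_(m+2) is the convex combination with weights Q
    and 1 - Q of 1 - 60/7 l and 1 - l c, both nonnegative, and 1 - l c is
    gamma (99/4 l + 384/225) / e.  The coefficient of gamma exceeds 4. *)
Lemma r_lower m : 4 * gamma_ R m.+2 <= L * `|r_ R m.+2|.
Proof.
have L1 := ln109_ge (R := R); have L2 := ln109_le (R := R).
have G1 := gamma_le m; have G0 := gamma_ge m.+2.
have p0 : 0 < (9 / 16) ^+ m.+2 :> R by rewrite exprn_gt0; lra.
rewrite /r_ /=; move: (gamma_ _ _) (ln _) L1 L2 G1 G0 => G l L1 L2 G1 G0.
set e := 15 / 4 * l + 384 / 225 * G.
have e0 : 0 < e by rewrite /e; lra.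
have e1 : e <= 1 by rewrite /e; lra.
have -> : 1 - 15 / 4 * l - 384 / 225 * G = 1 - e by rewrite /e; ring.
set Q := (1 - e) ^+ m.+1.
have B0 : 0 <= G * (99 / 4 * l + 384 / 225) by rewrite mulr_ge0; lra.
have := @relax_ge e Q (1 - 60 / 7 * l) (G * (99 / 4 * l + 384 / 225)) m _ _ B0 erefl.
rewrite e0 e1 => /(_ isT ltac:(lra)) H.
rewrite -normrN -[X in X * `|_|]gtr0_norm; last lra.
rewrite -normrM; apply: le_trans (ler_norm _).
set c := (15 / 4 - 99 / 4 * G) / e.
have cE : G * (99 / 4 * l + 384 / 225) / e = 1 - l * c.
  have ne : e != 0 by rewrite gt_eqF.
  apply: (mulIf ne); rewrite /= divfK // mulrBl -(mulrA l) /c divfK // /e; ring.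
rewrite (_ : l * _ = (1 - 60 / 7 * l) * Q + (1 - l * c) * (1 - Q)).
  by rewrite -cE; apply: le_trans H; nra.
by field; rewrite gt_eqF //; lra.
Qed.

(** As in [r_lower], for the combination of 21/2 l - 1 and l c - 1.  Here the
    upper bound on gamma is what keeps e positive. *)
Lemma d_lower m : 4 * gamma_ R m.+2 <= L * `|d_ R m.+2|.
Proof.
have L1 := ln109_ge (R := R); have L2 := ln109_le (R := R).
have G1 := gamma_le m; have G0 := gamma_ge m.+2.
have p0 : 0 < (9 / 16) ^+ m.+2 :> R by rewrite exprn_gt0; lra.
rewrite /d_ /=; move: (gamma_ _ _) (ln _) L1 L2 G1 G0 => G l L1 L2 G1 G0.
set e := 15 / 4 * l - 384 / 225 * G.
have e0 : 0 < e by rewrite /e; lra.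
have e1 : e <= 1 by rewrite /e; lra.
have -> : 1 - 15 / 4 * l + 384 / 225 * G = 1 - e by rewrite /e; ring.
set Q := (1 - e) ^+ m.+1.
have B0 : 0 <= G * (99 / 4 * l + 384 / 225) by rewrite mulr_ge0; lra.
have := @relax_ge e Q (21 / 2 * l - 1) (G * (99 / 4 * l + 384 / 225)) m _ _ B0 erefl.
rewrite e0 e1 => /(_ isT ltac:(lra)) H.
rewrite -[X in X * `|_|]gtr0_norm; last lra.
rewrite -normrM; apply: le_trans (ler_norm _).
set c := (99 / 4 * G + 15 / 4) / e.
have cE : G * (99 / 4 * l + 384 / 225) / e = l * c - 1.
  have ne : e != 0 by rewrite gt_eqF.
  apply: (mulIf ne); rewrite /= divfK // mulrBl -(mulrA l) /c divfK // /e; ring.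
rewrite (_ : l * _ = (21 / 2 * l - 1) * Q + (l * c - 1) * (1 - Q)).
  by rewrite -cE; apply: le_trans H; nra.
by field; rewrite gt_eqF //; lra.
Qed.

Lemma r1_lower : 5 / 8 * L <= L * `|r_ R 1|.
Proof.
have L1 := ln109_ge (R := R); have L2 := ln109_le (R := R).
rewrite /r_ /= mulr1 -addrA subrK; move: (ln _) L1 L2 => l L1 L2.
rewrite -normrN -[X in _ <= X * `|_|]gtr0_norm; last lra.
rewrite -normrM; apply: le_trans (ler_norm _).
rewrite (_ : l * _ = 1 - 60 / 7 * l); first lra.
by field; rewrite gt_eqF //; lra.
Qed.

Lemma d1_lower : 5 / 8 * L <= L * `|d_ R 1|.
Proof.
have L1 := ln109_ge (R := R); have L2 := ln109_le (R := R).
rewrite /d_ /= mulr1 -addrA subrK; move: (ln _) L1 L2 => l L1 L2.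
rewrite -[X in _ <= X * `|_|]gtr0_norm; last lra.
rewrite -normrM; apply: le_trans (ler_norm _).
rewrite (_ : l * _ = 21 / 2 * l - 1); first lra.
by field; rewrite gt_eqF //; lra.
Qed.

(** As (13/16)^3 < 9/16, it is enough that n >= 3 (m + 1), which follows from
    n >= (m + 2)^2. *)
Lemma exp_error_le_gamma n m : (m.+2 ^ 2 <= n)%N ->
  5 / 4 * L * (13 / 16) ^+ n <= 4 * gamma_ R m.+2.
Proof.
move=> mn; have L1 := ln109_ge (R := R); have L2 := ln109_le (R := R).
have E : (13 / 16) ^+ n <= (9 / 16) ^+ m.+1 :> R.
  apply: (@le_trans _ _ ((13 / 16) ^+ (3 * m.+1))).
    by rewrite ler_wiXn2l //; (lra || nia).
  by rewrite exprM lerXn2r ?nnegrE //; rewrite ?exprn_ge0 //; lra.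
have p0 : 0 < (9 / 16) ^+ m.+1 :> R by rewrite exprn_gt0; lra.
have := gamma_ge m.+2; rewrite exprS.
move: (gamma_ _ _) ((9 / 16) ^+ _) p0 E => G p p0 E GE.
apply: (@le_trans _ _ (5 / 4 * L * p)); first by rewrite ler_wpM2l //; lra.
by have : (L * p <= (1 / 19 + 1 / 18) * p) by [rewrite ler_wpM2r // ltW]; lra.
Qed.

End GammaBounds.

Theorem theorem14 (R : realType) (alpha : R -> nat -> R)
    (halpha : expansion_choice alpha) (n : nat) (hn : (1 <= n)%N)
    (x : R) (hx : Ihalf x) :
  let m := Num.truncn (Num.sqrt (n%:R : R)) in
  - ln (10 / 9) * `|r_ R m|
    <= distr_shift alpha n x - 1 / ln (10 / 9) * ln (5 * (x + 1) / (3 * (x + 2)))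
    <= ln (10 / 9) * `|d_ R m|.
Proof.
cbv zeta; set m := Num.truncn _; have m0 : (0 < m)%N.
  by rewrite truncn_gt0 -[leLHS]sqrtr1 ler_sqrt ?ler1n.
have mn : (m ^ 2 <= n)%N.
  rewrite -(ler_nat R) natrX -[leRHS]sqr_sqrtr ?ler0n //.
  by rewrite lerXn2r ?nnegrE ?ler0n ?sqrtr_ge0 // truncn_le sqrtr_ge0.
rewrite distr_shiftE //; rewrite IhalfE in hx.
rewrite mulNr; set e := (X in _ <= X <= _).
suff [er ed] : `|e| <= ln (10 / 9) * `|r_ R m| /\ `|e| <= ln (10 / 9) * `|d_ R m|.
  rewrite lerNl; apply/andP; split.
    by apply: le_trans er; rewrite -normrN; exact: ler_norm.
  by apply: le_trans ed; exact: ler_norm.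
case: (m) m0 mn => [//|[|k]] _ mn.
  have eL := cdf_error_le _ _ hn hx.
  by split; apply: (le_trans eL); [exact: r1_lower|exact: d1_lower].
have eG := le_trans (cdf_error_exp n _ hx) (exp_error_le_gamma _ _ mn).
by split; apply: (le_trans eG); [exact: r_lower|exact: d_lower].
Qed.
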